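(* Let $G$ be a hyperbolic group. Then for every finite generating set $X$ of $G$ there exists a constant $C=C(X,\delta)$, where $\delta$ is a hyperbolicity constant of the Cayley graph of $G$ with respect to $X$, such that $\operatorname{PCL}_{G,X}(n)\le C$ for all $n\in\mathbb{N}$.
   Context: Generating sets are assumed to generate groups as monoids (they need not be closed under inversion). A word on $X$ also denotes the element of $G$ it represents. For a word $u$, $\ell(u)$ is its number of letters; for an element $g\in G$, $\ell(g)=|g|_X$ is the least length of a word on $X$ representing $g$. A word $u$ is geodesic if $\ell(u)=|u|_X$. A cyclic permutation of a word $u\equiv x_1\ldots x_r$ is a word $x_i\ldots x_rx_1\ldots x_{i-1}$, $i=1,\ldots,r$ (the empty word is its own cyclic permutation). If words $u,v$ on $X$ represent conjugate elements of $G$, a PC-conjugator for $u,v$ is an element $w\in G$ such that $wu'=v'w$ in $G$ for some cyclic permutations $u'$ of $u$ and $v'$ of $v$. Put $\operatorname{PCL}_{G,X}(u,v)=\min\{\ell(w)\mid w \text{ is a PC-conjugator for } u,v\}$ and, for $n\in\mathbb{N}$, $\operatorname{PCL}_{G,X}(n)=\max\{\operatorname{PCL}_{G,X}(u,v)\}$ over all geodesic words $u,v$ on $X$ representing conjugate elements of $G$ with $\ell(u)+\ell(v)\le n$. *)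

(* Defs.v *)
From HB Require Import structures.
From mathcomp Require Import all_boot all_order all_algebra finmap.
From mathcomp Require Import boolp classical_sets reals.

Set Implicit Arguments.
Unset Strict Implicit.
Unset Printing Implicit Defensive.
Import Order.TTheory GRing.Theory Num.Theory.

(* The least element of P; junk value 0 when P is empty. *)
Definition nat_min (P : set nat) : nat :=
  xget 0 [set n | P n /\ forall m, P m -> n <= m]%classic.

Section Words.
Variables (G : groupType) (X : {fset G}).
Local Open Scope group_scope.

(* Words on X are sequences u : seq X; no inverses of letters are allowed. *)
Definition word_val (u : seq X) : G := \prod_(x <- u) fsval x.

Definition monoid_generating : Prop := forall g : G, exists u, word_val u = g.

Definition word_length (g : G) : nat :=
  nat_min [set n | exists u : seq X, word_val u = g /\ size u = n]%classic.

Definition geodesic_word (u : seq X) : Prop := size u = word_length (word_val u).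

Definition conjugate_words (u v : seq X) : Prop :=
  exists g : G, g * word_val u = word_val v * g.

Definition cyclic_permutation (u u' : seq X) : Prop := exists i, u' = rot i u.

Definition PC_conjugator (u v : seq X) (w : G) : Prop :=
  exists u' v' : seq X,
    [/\ cyclic_permutation u u', cyclic_permutation v v'
      & w * word_val u' = word_val v' * w].

Definition PCL_words (u v : seq X) : nat :=
  nat_min [set n | exists w, PC_conjugator u v w /\ word_length w = n]%classic.

(* The maximum ranges over a nonempty finite set: the pair of empty words is
   always admissible. *)
Definition PCL (n : nat) : nat :=
  \max_(p : n.-bseq X * n.-bseq X |
      `[< [/\ geodesic_word p.1, geodesic_word p.2, conjugate_words p.1 p.2
            & (size p.1 + size p.2 <= n)%N] >])
    PCL_words p.1 p.2.

End Words.

Section SlimTriangles.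
Variables (R : realType) (T : Type) (d : T -> T -> R).
Local Open Scope ring_scope.

Definition geodesic_segment (a b : T) (L : R) (c : R -> T) : Prop :=
  [/\ 0 <= L, c 0 = a, c L = b
    & forall s t, 0 <= s <= L -> 0 <= t <= L -> d (c s) (c t) = `|s - t|].

Definition near_segment (delta : R) (p : T) (L : R) (c : R -> T) : Prop :=
  exists2 s, 0 <= s <= L & d p (c s) <= delta.

(* Only one side is required to be close to the other two: the conditions on
   the remaining sides are instances for the relabelled triangles. *)
Definition slim_triangles (delta : R) : Prop :=
  forall (x y z : T) (La Lb Lc : R) (a b c : R -> T),
    geodesic_segment x y La a ->
    geodesic_segment y z Lb b ->
    geodesic_segment z x Lc c ->
    forall s, 0 <= s <= La ->
      near_segment delta (a s) Lb b \/ near_segment delta (a s) Lc c.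

End SlimTriangles.

Section CayleyGraph.
Variables (R : realType) (G : groupType) (X : {fset G}).

Definition sym_closure : {fset G} := (X `|` [fset x^-1%g | x in X])%fset.

(* The combinatorial distance in the undirected graph with an edge between g
   and g * x for all g in G and x in X. *)
Definition vertex_dist (g h : G) : nat := word_length sym_closure (g^-1 * h)%g.

Local Open Scope ring_scope.

(* The points of the geometric realization, with one unit edge from g to g * x
   for each pair (g, x) in G * X: [CayleyInterior g x t] lies on the open edge
   (g, x) at distance t from g along this edge. *)
Inductive cayley_point :=
  | CayleyVertex of G
  | CayleyInterior of G & X & {t : R | 0 < t < 1}.

(* The endpoints of the closed cell containing p, each with the length of the
   arc of this cell joining it to p. *)
Definition exit0 (p : cayley_point) : G * R :=
  match p with
  | CayleyVertex g => (g, 0)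
  | CayleyInterior g x t => (g, val t)
  end.

Definition exit1 (p : cayley_point) : G * R :=
  match p with
  | CayleyVertex g => (g, 0)
  | CayleyInterior g x t => ((g * val x)%g, 1 - val t)
  end.

Definition via_vertices (e f : G * R) : R :=
  e.2 + (vertex_dist e.1 f.1)%:R + f.2.

(* The length metric: a shortest path joins p and q through endpoints of their
   edges, or stays inside a common edge. *)
Definition cayley_dist (p q : cayley_point) : R :=
  let m := Num.min
    (Num.min (via_vertices (exit0 p) (exit0 q)) (via_vertices (exit0 p) (exit1 q)))
    (Num.min (via_vertices (exit1 p) (exit0 q)) (via_vertices (exit1 p) (exit1 q)))
  in
  match p, q with
  | CayleyInterior g x t, CayleyInterior h y s =>
      if (g == h) && (x == y) then Num.min m `|val t - val s| else m
  | _, _ => m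
  end.

Definition hyperbolicity_constant (delta : R) : Prop :=
  slim_triangles cayley_dist delta.

End CayleyGraph.

Definition hyperbolic_group (R : realType) (G : groupType) : Prop :=
  exists X : {fset G},
    monoid_generating X /\ exists delta : R, hyperbolicity_constant X delta.

(* Main.v *)
Require Import Defs.
From mathcomp Require Import all_boot all_order all_algebra finmap.
From mathcomp Require Import boolp classical_sets reals.
From mathcomp Require Import zify lra.

(* Everything takes place in the word metrics on G.  Slimness of triangles in
   the Cayley graph amounts to uniform slimness of the intervals
   {w | d(x,w) + d(w,y) = d(x,y)}, and also to Gromov's four-point condition.

   Independence of the generating set: the intervals of one word metric are a
   slim family of coarse paths for the other one, and such a family is uniformly
   close to every quasigeodesic with the same endpoints.

   Conjugators: let h = u = g^-1 v g.  The letters of u and v trace quasigeodesics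
   p from 1 to h and q from g^-1 to h g^-1, and an element y^-1 x, with x and y on
   h-translates of p and q, is a PC-conjugator.  If both paths have a vertex
   moved by h a bounded distance, two cyclic permutations represent elements of a
   fixed ball, where there are finitely many conjugate pairs.  Otherwise, say, the
   midpoint m of p is moved far; then h m is almost between m and h^2 m, and a
   path from b to h b must pass near m or h m, provided m and b are chosen closest
   within their h-orbits. *)

(** * Hyperbolicity of integer-valued path metrics *)

Lemma exists_switch (Q : nat -> Prop) N : Q 0 -> ~ Q N -> exists2 s, s < N & Q s /\ ~ Q s.+1.
Proof.
elim: N => [//|N IH] Q0 QN; have [QN'|nQ] := EM (Q N); first by exists N.
by have [s sN Qs] := IH Q0 nQ; exists s => //; apply: leqW.
Qed.

Lemma linear_le_exp2 A B : exists k0, forall k, k0 <= k -> A * k + B <= 2 ^ k.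
Proof.
have sq k : k * k <= 2 * 2 ^ k.
  elim: k => [//|k IH]; rewrite expnS; have := ltn_expl k (isT : 1 < 2); nia.
exists (2 * (A + B) + 1) => k hk; have := sq k.
have : 2 * (A * k + B) <= k * k by nia.
lia.
Qed.

(** Taking [k] of order [t / C.+1] makes [2 ^ k] outgrow any linear function of [t]. This is how a
    logarithmic estimate beats a linear one in [slim_family_near_quasigeodesic]. *)
Lemma exp2_beats_linear A B C D :
  exists t0, forall t, t0 < t -> exists k, A * t + B <= 2 ^ k /\ C * k + D < t.
Proof.
have [k0 hk0] := linear_le_exp2 (A * C.+1) (A * (C.+1 + D + 1) + B).
exists (C.+1 * k0 + D + 1) => t ht; exists ((t.-1 - D) %/ C.+1).
set k := _ %/ _.
have e := divn_eq (t.-1 - D) C.+1; have l := ltn_pmod (t.-1 - D) (ltn0Sn C).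
rewrite -/k in e.
have k0k : k0 <= k by rewrite leq_divRL //; lia.
split; last by nia.
apply: leq_trans (hk0 _ k0k).
have : t <= C.+1 * k + C.+1 + D + 1 by nia.
nia.
Qed.

Section GraphMetric.
Variables (T : Type) (d : T -> T -> nat).

Record graph_metric : Prop := GraphMetric {
  gm_xx : forall x, d x x = 0;
  gm_sep : forall x y, d x y = 0 -> x = y;
  gm_sym : forall x y, d x y = d y x;
  gm_tri : forall x y z, d x z <= d x y + d y z;
  gm_geo : forall x y k, k <= d x y -> exists2 w, d x w = k & d w y = d x y - k }.

Definition between (x y w : T) : Prop := d x w + d w y = d x y.

Definition four_point (delta : nat) : Prop :=
  forall x y z w, d x y + d z w <= maxn (d x z + d y w) (d x w + d y z) + delta.

(** Think of [L x y] as the points of a coarse path from [x] to [y]. It is kept abstract so that the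
    intervals of one metric can be measured by another; [slim_short] starts the inductions by
    bisection. *)
Record slim_family (L : T -> T -> T -> Prop) (h : nat) : Prop := SlimFamily {
  slim_triangle : forall x y z w, L x y w ->
    exists2 w', L x z w' \/ L z y w' & d w w' <= h;
  slim_short : forall x y w, d x y <= 1 -> L x y w -> d x w <= h }.

(** There is no additive constant, so in a graph metric [K = 1] means exactly a geodesic path. *)
Record quasigeodesic (K n : nat) (p : nat -> T) : Prop := Quasigeodesic {
  qg_step : forall i, i < n -> d (p i) (p i.+1) <= 1;
  qg_lower : forall i j, i <= j <= n -> j - i <= K * d (p i) (p j) }.

Hypothesis dm : graph_metric.
Let dxx := gm_xx dm.
Let dC := gm_sym dm.
Let dT := gm_tri dm.

Lemma quasigeodesic_upper n p i j :
  (forall i, i < n -> d (p i) (p i.+1) <= 1) -> i <= j <= n -> d (p i) (p j) <= j - i.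
Proof.
move=> st; elim: j => [|j IH] ij; first by rewrite (_ : i = 0) ?dxx; lia.
have [->|ne] := eqVneq i j.+1; first by rewrite dxx.
have := dT (p i) (p j) (p j.+1); have := st j; have := IH; lia.
Qed.

Lemma geodesic_path x y : exists p : nat -> T,
  [/\ p 0 = x, p (d x y) = y & forall i, i < d x y -> d (p i) (p i.+1) <= 1].
Proof.
have [n e] : exists n, d x y = n by exists (d x y).
rewrite e; elim: n x e => [|n IH] x e.
  by exists (fun=> x); split=> //; rewrite (gm_sep dm _ _ e).
have [|w w1 w2] := @gm_geo dm x y 1; first by lia.
have [|p [p0 pn ps]] := IH w; first by lia.
exists (fun i => if i is i'.+1 then p i' else x); split=> // -[_|i ii] /=.
  by rewrite p0 w1.
exact: ps.
Qed.

(** Geodesics from [x] to [w] and from [w] to [y] concatenate to a path as long as the distance of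
    its ends, so by the triangle inequality no piece of it can be shortened. *)
Lemma geodesic_path_through x y w : between x y w -> exists p : nat -> T,
  [/\ p 0 = x, p (d x w) = w, p (d x y) = y & quasigeodesic 1 (d x y) p].
Proof.
move=> b; have [p [p0 pn ps]] := geodesic_path x w.
have [q [q0 qn qs]] := geodesic_path w y.
pose r i := if i <= d x w then p i else q (i - d x w).
have r0 : r 0 = x by rewrite /r.
have rn : r (d x y) = y.
  rewrite /r; case: ifP => h; first last.
    by have -> : d x y - d x w = d w y by move: b; rewrite /between; lia.
  have wy : d w y = 0 by move: b; rewrite /between; lia.
  have -> : d x y = d x w by move: b; rewrite /between; lia.
  by rewrite pn; apply: (gm_sep dm).
have rs i : i < d x y -> d (r i) (r i.+1) <= 1.
  move=> ii; rewrite /r; case: (ltngtP i (d x w)) => h; first exact: ps.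
    rewrite subSn; last by lia.
    by apply: qs; move: b; rewrite /between; lia.
  by rewrite h pn subSnn -q0; apply: qs; move: b; rewrite /between; lia.
exists r; split => //; first by rewrite /r leqnn.
split=> // i j ij.
have := quasigeodesic_upper (d x y) r 0 i rs; have := quasigeodesic_upper (d x y) r j (d x y) rs.
have := dT x (r i) y; have := dT (r i) (r j) y; rewrite r0 rn; lia.
Qed.

(** * Slim families along quasigeodesics *)

Section SlimFamilies.
Variables (L : T -> T -> T -> Prop) (h : nat).
Hypothesis sL : slim_family L h.

(** Bisection: splitting the path replaces [L (p i) (p j)] by one of the other two sides of a slim
    triangle and costs [h]; after [k] splittings at most one step is left. *)
Lemma slim_log_bound (p : nat -> T) k i j w :
  (forall m, i <= m < j -> d (p m) (p m.+1) <= 1) -> i <= j <= i + 2 ^ k ->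
  L (p i) (p j) w -> exists2 m, i <= m <= j & d w (p m) <= h * k.+1.
Proof.
elim: k i j w => [|k IH] i j w st ij Lw.
  exists i; first by lia.
  rewrite dC muln1; apply: (slim_short _ _ sL _ _ _ _ Lw).
  have [->|ne] := eqVneq i j; first by rewrite dxx.
  have -> : j = i.+1 by lia.
  by apply: st; lia.
have [j2|j2] := leqP j (i + 2 ^ k).
  have [|m im dm'] := IH i j w st _ Lw; first by lia.
  exists m => //; lia.
have [w' [Lw'|Lw'] ww'] := slim_triangle _ _ sL _ _ (p (i + 2 ^ k)) _ Lw.
- have [m' ?||m im dm'] := IH i (i + 2 ^ k) w' _ _ Lw'; [by apply: st; lia|by lia|].
  exists m; first by lia.
  have := dT w w' (p m); lia.
- have [m' ?||m im dm'] := IH (i + 2 ^ k) j w' _ _ Lw'; [by apply: st; lia| |].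
    by move: ij; rewrite expnS; lia.
  exists m; first by lia.
  have := dT w w' (p m); lia.
Qed.

(* The bound t on the distance from L (p i) (p j) to the path p is lowered one
   unit at a time: a point at distance t from p m is close to
   L (p (m - r)) (p (m + r)) with r linear in t, to which the logarithmic bound
   applies. *)
Lemma slim_family_near_quasigeodesic K : exists t, forall n p, quasigeodesic K.+1 n p ->
  forall i j w, i <= j <= n -> L (p i) (p j) w ->
  exists2 m, i <= m <= j & d w (p m) <= t.
Proof.
have [t0 ht0] := exp2_beats_linear (4 * K.+1) (4 * K.+1 * (h + 1)) h (3 * h + 2).
exists (t0 + 3 * h) => n p [st lo].
pose P t := forall i j w, i <= j <= n -> L (p i) (p j) w ->
  exists2 m, i <= m <= j & d w (p m) <= t.
suff dec t : P (t0 + 3 * h + t) -> P (t0 + 3 * h).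
  (* [slim_log_bound] with [k = n] gives a first bound, which depends on [n]. *)
  apply: (dec (h * n.+1)) => i j w ij Lw.
  have [||m im dm'] := slim_log_bound p n i j w _ _ Lw.
  - by move=> m ?; apply: st; lia.
  - have := @ltn_expl 2 n isT; lia.
  by exists m => //; lia.
elim: t => [|t IH]; first by rewrite addn0.
rewrite addnS => Pt; apply: IH; move: (t0 + 3 * h + t) (leq_addr t (t0 + 3 * h)) Pt => {}t t0t Pt i j w ij Lw.
apply: contrapT => /forall2NP far.
have {}far m : i <= m <= j -> t < d w (p m).
  by move=> im; have [|/negP] := far m; first by []; lia.
have [m im wm] := Pt _ _ _ ij Lw.
have [|k [k1 k2]] := ht0 t.+1; first by lia.
(* Vertices of [p] at least [r] steps apart are at distance at least [2 * t + 2 * h + 3], more than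
   a detour through [w] allows. So [w] is not close to the outer pieces [L (p i) (p a)] and
   [L (p b) (p j)]; when [a = i] or [b = j], [slim_short] excludes the degenerate piece. *)
pose r := K.+1 * (2 * t + 2 * h + 3).
have rk : 2 * r <= 2 ^ k by rewrite /r; nia.
pose a := maxn i (m - r); pose b := minn j (m + r).
have ab : [/\ i <= a, a <= m, m <= b & b <= j] by rewrite /a /b; split; lia.
case: ab => ia am mb bj.
have [w1 Lw1 ww1] := slim_triangle _ _ sL _ _ (p a) _ Lw.
case: Lw1 => Lw1.
  have [e|ne] := eqVneq a i.
    have := slim_short _ _ sL _ _ _ _ Lw1; rewrite e dxx => /(_ isT) iw.
    have := far i; have := dT w w1 (p i); rewrite (dC w1 (p i)); lia.
  have ea : a = m - r by move: ne; rewrite /a; lia.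
  have [|m' im' wm'] := Pt _ _ _ _ Lw1; first by lia.
  have lo' : m - m' <= K.+1 * d (p m') (p m) by apply: lo; lia.
  have := dT (p m') w1 (p m); have := dT w1 w (p m); rewrite (dC (p m') w1) (dC w1 w) => h1 h2.
  have h3 : d (p m') (p m) < 2 * t + 2 * h + 3 by lia.
  have h4 : r <= m - m' by move: ne im'; rewrite ea /a; lia.
  have h5 : K.+1 * d (p m') (p m) < r by rewrite /r ltn_pmul2l.
  lia.
have [w2 Lw2 w12] := slim_triangle _ _ sL _ _ (p b) _ Lw1.
have ww2 : d w w2 <= 2 * h by have := dT w w1 w2; lia.
case: Lw2 => Lw2.
  (* The window has at most [2 * r <= 2 ^ k] steps, so the logarithmic bound would put [w] within
     [t] of [p]. *)
  have [||m' im' wm'] := slim_log_bound p k a b w2 _ _ Lw2.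
  - by move=> ? ?; apply: st; lia.
  - by rewrite /a /b; lia.
  have fm : t < d w (p m') by apply: far; lia.
  have := dT w w2 (p m'); rewrite mulnS in wm'; lia.
have [e|ne] := eqVneq b j.
  have := slim_short _ _ sL _ _ _ _ Lw2; rewrite e dxx => /(_ isT) iw.
  have := far j; have := dT w w2 (p j); rewrite (dC w2 (p j)); lia.
have eb : b = m + r by move: ne; rewrite /b; lia.
have [|m' im' wm'] := Pt _ _ _ _ Lw2; first by lia.
have lo' : m' - m <= K.+1 * d (p m) (p m') by apply: lo; lia.
have := dT (p m) w2 (p m'); have := dT (p m) w w2; rewrite (dC (p m) w) => h1 h2.
have h3 : d (p m) (p m') < 2 * t + 2 * h + 3 by lia.
have h4 : r <= m' - m by move: ne im'; rewrite eb /b; lia.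
have h5 : K.+1 * d (p m) (p m') < r by rewrite /r ltn_pmul2l.
lia.
Qed.

End SlimFamilies.

(** Connectedness: somewhere along [q] a point close to the part of [p] up to [m] is followed by one
    close only to the part after [m]. The two indices on [p] differ by at most [K * (2 * t + s)],
    and [m] lies between them. *)
Lemma quasigeodesic_near_family (L : T -> Prop) K n p t s N (q : nat -> T) :
  quasigeodesic K n p ->
  (forall w, L w -> exists2 m, m <= n & d w (p m) <= t) ->
  q 0 = p 0 -> q N = p n -> (forall i, i <= N -> L (q i)) ->
  (forall i, i < N -> d (q i) (q i.+1) <= s) ->
  forall m, m <= n -> exists2 w, L w & d (p m) w <= t + K * (2 * t + s).
Proof.
move=> [st lo] near q0 qN Lq qs m mn.
have up := quasigeodesic_upper _ p _ _ st.
pose Q i := exists2 j, j <= m & d (q i) (p j) <= t.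
have [[j jm dj]|nQ] := EM (Q N).
  exists (q N); first exact: Lq.
  rewrite qN; apply: leq_trans (up m n _) _; first by lia.
  have lo' : n - j <= K * d (p j) (p n) by apply: lo; lia.
  move: dj; rewrite qN (dC (p n)) => dj; nia.
have [|i iN [[j jm dj] nQ1]] := exists_switch Q N _ nQ.
  by exists 0 => //; rewrite q0 dxx.
have [j' jn' dj'] := near (q i.+1) (Lq _ iN).
have mj' : m < j' by rewrite ltnNge; apply/negP => ?; apply: nQ1; exists j'.
exists (q i); first by apply: Lq; lia.
have qi := qs _ iN.
have lo' : j' - j <= K * d (p j) (p j') by apply: lo; lia.
have up' : d (p j) (p m) <= m - j by apply: up; lia.
have := dT (p j) (q i) (p j'); have := dT (q i) (q i.+1) (p j').
have := dT (p m) (p j) (q i); rewrite (dC (p j) (q i)) (dC (p m) (p j)) => h1 h2 h3.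
have h4 : d (p j) (p j') <= 2 * t + s by lia.
nia.
Qed.

Lemma quasigeodesic1_between n p m : quasigeodesic 1 n p -> m <= n -> d (p 0) (p n) = n ->
  between (p 0) (p n) (p m).
Proof.
move=> [st _] mn e; have := dT (p 0) (p m) (p n).
have := quasigeodesic_upper n p 0 m st; have := quasigeodesic_upper n p m n st.
rewrite /between; lia.
Qed.

(** The distance from [w] to an interval is, up to an additive error, the Gromov product of its ends
    at [w]. A slim triangle moves a point of the interval of [x, y] close to [w] into an interval
    ending at [z], and so bounds the smaller of the products of [x, z] and of [z, y]. *)
Lemma slim_intervals_four_point h : slim_family between h -> four_point (6 * h + 2).
Proof.
move=> sl.
have near x y w : exists2 z, between x y z & 2 * d w z + d x y <= d w x + d w y + 4 * h + 2.
  have bx : between x y x by rewrite /between dxx.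
  have [p [p0 _ pn qp]] := geodesic_path_through x y x bx.
  have bp i : i <= d x y -> between x y (p i).
    by move=> ii; rewrite -{1}p0 -pn; apply: quasigeodesic1_between; rewrite ?p0 ?pn.
  (* The point sought is close to the side from [x] to [w] while its successor is not; the successor
     is then close to the side from [w] to [y]. *)
  pose Q i := exists2 w', between x w w' & d (p i) w' <= h.
  have [[w']|nQ] := EM (Q (d x y)).
    rewrite pn /between => b yw'; exists y; first by rewrite /between dxx addn0.
    have := dT x w' y; have := dT y w' w; have := dC w' y; have := dC y w; have := dC x w; lia.
  have [|i iN [[w' b' pw'] nQ1]] := exists_switch Q _ _ nQ.
    by exists x; rewrite ?p0 /between ?dxx.
  have [w'' [b''|b''] pw''] := slim_triangle _ _ sl _ _ w _ (bp _ iN).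
    by case: nQ1; exists w''.
  exists (p i); first by apply: bp; lia.
  case: qp => st _; have {}st := st _ iN.
  move: b' b'' (bp i (ltnW iN)); rewrite /between.
  have := dT x w' (p i); have := dT (p i) w' w.
  have := dT (p i) (p i.+1) w''; have := dT w w'' (p i); have := dT (p i) w'' y.
  have := dC w' (p i); have := dC w'' (p i); have := dC w (p i); have := dC w x.
  have := dC (p i) w''; have := dC w w''; lia.
move=> x y z w; have [p bp wp] := near x y w.
have [p' bp' pp'] := slim_triangle _ _ sl _ _ z _ bp.
have := dT w p p'; case: bp'; rewrite /between => bp'.
- have := dT w p' x; have := dT w p' z; have := dC p' x; have := dC w x; have := dC w y; have := dC w z; lia.
- have := dT w p' z; have := dT w p' y; have := dC p' z; have := dC y z; have := dC w x; have := dC w y; have := dC w z; lia.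
Qed.

Lemma four_point_near_interval delta x y z c : four_point delta ->
  d x z + d z y <= d x y + c -> exists2 w, between x y w & d z w <= c + delta.
Proof.
move=> fp xyz; have [xy|xy] := leqP (d x z) (d x y).
  have [w w1 w2] := gm_geo dm _ _ _ xy.
  exists w; first by rewrite /between; lia.
  have := fp x y z w; have := dC y w; have := dC y z; lia.
exists y; first by rewrite /between dxx addn0.
lia.
Qed.

(** * Quasigeodesics and isometries in a hyperbolic metric *)

Section Hyperbolic.
Variables (h delta : nat).
Hypothesis sl : slim_family between h.
Hypothesis fp : four_point delta.

Lemma near_quasigeodesic K : exists t, forall n p, quasigeodesic K.+1 n p ->
  forall z c, d (p 0) z + d z (p n) <= d (p 0) (p n) + c ->
  exists2 m, m <= n & d z (p m) <= c + t.
Proof.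
have [t ht] := slim_family_near_quasigeodesic _ _ sl K.
exists (delta + t) => n p qp z c /(four_point_near_interval _ _ _ _ _ fp) [w bw zw].
have [|m mn wm] := ht _ _ qp 0 n w _ bw; first by lia.
exists m => //; have := dT z w (p m); lia.
Qed.

(** The other half of the Morse lemma, from [quasigeodesic_near_family] applied to a geodesic. It is
    expressed as a bounded defect in the triangle inequality, the form that the four-point
    computations use. *)
Lemma quasigeodesic_near_between K : exists e, forall n p, quasigeodesic K.+1 n p ->
  forall m, m <= n -> d (p 0) (p m) + d (p m) (p n) <= d (p 0) (p n) + e.
Proof.
have [t ht] := slim_family_near_quasigeodesic _ _ sl K.
exists (2 * (t + K.+1 * (2 * t + 1))) => n p qp m mn.
have b0 : between (p 0) (p n) (p 0) by rewrite /between dxx.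
have [q [q0 _ qn qq]] := geodesic_path_through _ _ _ b0.
have [|i iN||w bw mw] := quasigeodesic_near_family (between (p 0) (p n)) _ _ p t 1 _ q qp _ q0 qn _ _ m mn.
- by move=> w bw; have [|i] := ht _ _ qp 0 n w _ bw; [lia|exists i].
- rewrite -{1}q0 -qn; apply: quasigeodesic1_between => //; by rewrite ?q0 ?qn.
- by case: qq.
move: bw; rewrite /between; have := dT (p 0) w (p m); have := dT (p m) w (p n).
rewrite (dC w (p m)); lia.
Qed.

(** A discrete intermediate value argument: the difference of the two distances changes by at most 2
    in a unit step. *)
Lemma quasigeodesic_midpoint n p : (forall i, i < n -> d (p i) (p i.+1) <= 1) ->
  exists m, [/\ m <= n, d (p 0) (p m) <= d (p m) (p n) & d (p m) (p n) <= d (p 0) (p m) + 2].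
Proof.
move=> st; pose Q i := d (p 0) (p i) <= d (p i) (p n).
have [Qn|nQ] := EM (Q n).
  by exists n; split => //; move: Qn; rewrite /Q dxx; lia.
have [|i ii []] := exists_switch Q n _ nQ; first by rewrite /Q dxx.
rewrite /Q => Q1 Q2; exists i; split=> //; first exact: ltnW.
have := st _ ii; have := dT (p i) (p i.+1) (p n); have := dT (p 0) (p i) (p i.+1); lia.
Qed.

Section Isometry.
Variable f : T -> T.
Hypothesis fi : forall x y, d (f x) (f y) = d x y.

(** The large displacement leaves one term of the maximum in each four-point instance: the first
    bounds [d m (f (f a))] from below, the second turns this into a bound for [d m (f (f m))]. So
    [m], [f m], [f (f m)] behave like points of an axis of [f]. *)
Lemma midpoint_local_axis a m e :
  d a m + d m (f a) <= d a (f a) + e ->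
  d a m <= d m (f a) -> d m (f a) <= d a m + 2 ->
  e + 4 * delta + 2 < d m (f m) ->
  2 * d m (f m) <= d m (f (f m)) + (e + 4 * delta).
Proof.
move=> h1 h2 h3 h4.
have := fp (f a) (f (f a)) m (f m); have := fp m (f (f a)) (f (f m)) (f m).
have := fi a m; have := fi (f a) (f m); have := fi m (f m); have := fi m (f a).
have := fi (f m) (f a); have := fi a (f a); have := fi a (f m); have := fi m a; have := fi (f m) (f (f a)).
have := dC a m; have := dC (f (f a)) m; have := dC (f a) m; have := dC (f a) (f m); have := dC (f (f a)) (f m).
have := dC (f (f m)) (f m); have := dC (f (f a)) (f (f m)); have := fi (f a) (f (f a)); lia.
Qed.

(** Read [m] as a projection of [b] to an axis. If both [d (f b) m] and [d b (f m)] exceed [d b m]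
    by nearly [d m (f m)], one four-point instance suffices. If the first falls short, alignment of
    [m], [f m], [f (f m)] forces the second to be long, and [z = m]; the opposite case gives
    [z = f m]. *)
Lemma isometry_path_crosses_axis b m c :
  2 * d m (f m) <= d m (f (f m)) + c -> 2 * c + 8 * delta + 8 < d m (f m) ->
  d b m <= d (f b) m -> d b m <= d b (f m) ->
  exists2 z, z = m \/ z = f m & d b z + d z (f b) <= d b (f b) + (c + 6 * delta + 2).
Proof.
move=> h1 h2 h3 h4; set l := d m (f m) in h1 h2 *.
have e1 := fi b m; have e2 := fi (f b) m; have e3 := fi b (f m); have e4 := fi m (f m).
have e5 := fi (f b) (f m); have e6 := fi b (f b).
have s1 := dC m b; have s2 := dC m (f b); have s3 := dC (f m) (f b); have s4 := dC (f m) (f (f b)).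
have s5 := dC (f m) (f (f m)); have s6 := dC (f b) b; have s7 := dC (f (f m)) (f b).
have s8 := dC (f (f m)) (f (f b)); have s9 := dC (f m) b; have s10 := dC (f m) m.
have [A|A] := leqP (d b m + l) (d (f b) m + (c + 4 * delta)); last first.
  exists m; first by left.
  have := fp m (f (f m)) (f b) (f m); have := fp (f b) (f (f m)) (f (f b)) (f m).
  rewrite /l in A h1 h2 *; lia.
have [B|B] := leqP (d b m + l) (d b (f m) + (c + 4 * delta)); last first.
  exists (f m); first by right.
  have := fp m (f (f m)) (f b) (f m); have := fp m (f b) b (f m).
  rewrite /l in A B h1 h2 *; lia.
exists (f m); first by right.
have := fp m (f b) b (f m).
rewrite /l in A B h1 h2 *; lia.
Qed.

Lemma iter_isometry k x y : d (iter k f x) (iter k f y) = d x y.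
Proof. by elim: k => //= k IH; rewrite fi. Qed.

(** This supplies the two minimality assumptions of [isometry_path_crosses_axis]. They compare only
    with [f b] and [f m], so nonnegative powers of [f] suffice. *)
Lemma closest_translates b m : exists k l, forall k' l',
  d (iter l f b) (iter k f m) <= d (iter l' f b) (iter k' f m).
Proof.
pose P n := `[< exists k l, d (iter l f b) (iter k f m) = n >].
have exP : exists n, P n by exists (d b m); apply/asboolP; exists 0, 0.
case: (ex_minnP exP) => n /asboolP [k [l e]] min.
by exists k, l => k' l'; rewrite e; apply: min; apply/asboolP; exists k', l'.
Qed.

End Isometry.

Lemma small_displacement_or_close K : exists K1 C, forall f : T -> T,
  (forall x y, d (f x) (f y) = d x y) ->
  forall n p n' q, quasigeodesic K.+1 n p -> quasigeodesic K.+1 n' q ->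
  p n = f (p 0) -> q n' = f (q 0) ->
  (exists2 i, i <= n & d (p i) (f (p i)) <= K1) \/
  exists i j k l, [/\ i <= n, j <= n' & d (iter k f (p i)) (iter l f (q j)) <= C].
Proof.
have [t ht] := near_quasigeodesic K; have [e he] := quasigeodesic_near_between K.
(* The defect [e] at the midpoint of [p] gives alignment up to [c]. The threshold serves both lemmas
   on the axis, and [c + 6 * delta + 2] is the defect with which a translate of the midpoint lies
   between the ends of a translate of [q]. *)
pose c := e + 4 * delta; exists (2 * c + 8 * delta + 8), (c + 6 * delta + 2 + t).
move=> f fi n p n' q qp qq pn qn.
have [m [mn m1 m2]] := quasigeodesic_midpoint n p (qg_step _ _ _ qp).
have [small|large] := leqP (d (p m) (f (p m))) (2 * c + 8 * delta + 8); first by left; exists m.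
right; have he' := he _ _ qp _ mn; rewrite pn in m1 m2 he'.
have ax : 2 * d (p m) (f (p m)) <= d (p m) (f (f (p m))) + c.
  by apply: (midpoint_local_axis f fi (p 0)) => //; rewrite /c in large *; lia.
have [k [l min]] := closest_translates f (q 0) (p m).
have ii := iter_isometry f fi.
have [||||z zk zb] := isometry_path_crosses_axis f fi (iter l f (q 0)) (iter k f (p m)) c.
- by rewrite -!iterS !iterSr !ii.
- by rewrite -iterS iterSr ii.
- by rewrite -iterS; apply: min.
- by rewrite -iterS; apply: min.
have qq' : quasigeodesic K.+1 n' (fun j => iter l f (q j)).
  by case: qq => st lo; split => *; rewrite ii; [apply: st|apply: lo].
have [|j jn zj] := ht _ _ qq' z (c + 6 * delta + 2).
  by rewrite qn -iterSr iterS.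
by case: zk zj => -> zj; [exists m, j, k, l | exists m, j, k.+1, l].
Qed.

Lemma both_small_displacement_or_close K : exists K1 C, forall f : T -> T,
  (forall x y, d (f x) (f y) = d x y) ->
  forall n p n' q, quasigeodesic K.+1 n p -> quasigeodesic K.+1 n' q ->
  p n = f (p 0) -> q n' = f (q 0) ->
  (exists i j, [/\ i <= n, j <= n', d (p i) (f (p i)) <= K1 & d (q j) (f (q j)) <= K1]) \/
  exists i j k l, [/\ i <= n, j <= n' & d (iter k f (p i)) (iter l f (q j)) <= C].
Proof.
have [K1 [C H]] := small_displacement_or_close K.
exists K1, C => f fi n p n' q qp qq pn qn.
have [[i iin pi]|] := H f fi _ _ _ _ qp qq pn qn; last by right.
have [[j jn qj]|[j [i' [k [l [jn i'n h1]]]]]] := H f fi _ _ _ _ qq qp qn pn.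
  by left; exists i, j.
by right; exists i', j, l, k; split => //; rewrite dC.
Qed.

End Hyperbolic.
End GraphMetric.

Arguments quasigeodesic {T} d K n p.
Arguments between {T} d x y w.
Arguments slim_family {T} d L h.

(** * Slim intervals under a bilipschitz change of metric *)

Section Bilipschitz.
Variables (T : Type) (d1 d2 : T -> T -> nat) (M h : nat).
Hypotheses (dm1 : graph_metric T d1) (dm2 : graph_metric T d2).
Hypotheses (d12 : forall x y, d1 x y <= M * d2 x y) (d21 : forall x y, d2 x y <= M * d1 x y).
Hypothesis sl : slim_family d2 (between d2) h.

(** The summand [M] in the constant serves [slim_short]: points at [d1]-distance at most 1 are at
    [d2]-distance at most [M]. *)
Lemma bilipschitz_slim_family : slim_family d1 (between d2) (M * (h + M)).
Proof.
split=> [x y z w bw|x y w xy bw].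
  have [w' bw' ww'] := slim_triangle _ _ _ _ sl x y z w bw.
  exists w' => //; have := d12 w w'; nia.
have := d21 x y; have := d12 x w; move: bw; rewrite /between; nia.
Qed.

(* "Guessing geodesics" (Masur-Schleimer, Bowditch): since the d2-intervals form
   a slim family of connected sets for d1, they are uniformly close to the
   d1-geodesics. *)
Lemma bilipschitz_slim_intervals : exists h', slim_family d1 (between d1) h'.
Proof.
(* The final [0] stands for the quasigeodesic constant [0.+1], that is, for geodesics. *)
have [t ht] := slim_family_near_quasigeodesic _ _ dm1 _ _ bilipschitz_slim_family 0.
have near2 x y w : between d2 x y w -> exists2 w', between d1 x y w' & d1 w w' <= t.
  have b0 : between d1 x y x by rewrite /between (gm_xx _ _ dm1).
  have [p [p0 _ pn qp]] := geodesic_path_through _ _ dm1 _ _ _ b0.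
  rewrite -{1}p0 -{1}pn => bw; have [|m mn wm] := ht _ _ qp 0 _ w _ bw; first by lia.
  exists (p m) => //; rewrite -{1}p0 -pn.
  by apply: (quasigeodesic1_between _ _ dm1) => //; rewrite ?p0 ?pn.
(* Here [1] is the quasigeodesic constant, and [M] bounds the [d1]-steps of a [d2]-geodesic, which
   runs inside the [d2]-interval. *)
pose s := t + 1 * (2 * t + M).
have near1 x y w : between d1 x y w -> exists2 w', between d2 x y w' & d1 w w' <= s.
  move=> bw; have [p [p0 pw pn qp]] := geodesic_path_through _ _ dm1 _ _ _ bw.
  have b0 : between d2 x y x by rewrite /between (gm_xx _ _ dm2).
  have [q [q0 _ qn qq]] := geodesic_path_through _ _ dm2 _ _ _ b0.
  rewrite -pw; apply: (quasigeodesic_near_family _ _ dm1 _ _ _ p t M (d2 x y) q qp).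
  - move=> w' bw'; have := ht _ _ qp 0 (d1 x y) w'; rewrite p0 pn => /(_ _ bw') [|i ii wi].
      by lia.
    by exists i.
  - by rewrite q0.
  - by rewrite pn qn.
  - move=> i ii; rewrite -{1}q0 -qn.
    by apply: (quasigeodesic1_between _ _ dm2) => //; rewrite ?q0 ?qn.
  - move=> i ii; have := qg_step _ _ _ _ _ qq _ ii; have := d12 (q i) (q i.+1); nia.
  by move: bw; rewrite /between; lia.
exists (s + M * (h + M) + t + 1); split=> [x y z w bw|x y w xy].
  have [w1 b1 ww1] := near1 _ _ _ bw.
  have [w2 b2 w12] := slim_triangle _ _ _ _ bilipschitz_slim_family x y z w1 b1.
  have [w3 b3 w23] : exists2 w3, between d1 x z w3 \/ between d1 z y w3 & d1 w2 w3 <= t.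
    case: b2 => /near2 [w3 b3 w23]; exists w3 => //; by [left|right].
  exists w3 => //; have := gm_tri _ _ dm1 w w1 w3; have := gm_tri _ _ dm1 w1 w2 w3; lia.
rewrite /between; lia.
Qed.

End Bilipschitz.

(** * Word metrics *)

Lemma nat_minP (P : set nat) n : P n -> P (nat_min P) /\ nat_min P <= n.
Proof.
move=> Pn; rewrite /nat_min; have exP : exists n, `[< P n >] by exists n; apply/asboolP.
have [m /asboolP Pm min] := ex_minnP exP.
have [|Px le] := @xgetPex nat 0 [set n | P n /\ forall m, P m -> n <= m]%classic.
  by exists m; split=> // k Pk; apply: min; apply/asboolP.
by split=> //; apply: le.
Qed.

Section Words.
Variables (G : groupType) (X : {fset G}).
Local Open Scope group_scope.

Lemma word_val_nil : @word_val G X [::] = 1. Proof. exact: big_nil. Qed.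

Lemma word_val_cons (x : X) (u : seq X) : word_val (x :: u) = fsval x * word_val u.
Proof. exact: big_cons. Qed.

Lemma word_val_cat (u v : seq X) : word_val (u ++ v) = word_val u * word_val v.
Proof. exact: big_cat. Qed.

Lemma word_length_le (u : seq X) : (word_length X (word_val u) <= size u)%N.
Proof. by apply: (proj2 (nat_minP _ _ _)); exists u. Qed.

Lemma word_length1 : word_length X 1 = 0%N.
Proof. by have := word_length_le [::]; rewrite word_val_nil leqn0 => /eqP. Qed.

Hypothesis genX : monoid_generating X.

Lemma word_lengthP g : exists2 u : seq X, word_val u = g & size u = word_length X g.
Proof.
have [u ug] := genX g.
by have [[v [? ?]] _] := nat_minP [set n | exists u : seq X, word_val u = g /\ size u = n]%classic
  (size u) (ex_intro _ u (conj ug erefl)); exists v.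
Qed.

Lemma word_length_eq0 g : word_length X g = 0%N -> g = 1.
Proof. by have [u <- su] := word_lengthP g; rewrite -su => /size0nil ->; rewrite word_val_nil. Qed.

Lemma word_lengthM g h : (word_length X (g * h) <= word_length X g + word_length X h)%N.
Proof.
have [u <- <-] := word_lengthP g; have [v <- <-] := word_lengthP h.
by rewrite -word_val_cat -size_cat; apply: word_length_le.
Qed.

Lemma geodesic_word_infix (u v w : seq X) : geodesic_word (u ++ v ++ w) -> geodesic_word v.
Proof.
rewrite /geodesic_word !word_val_cat !size_cat => e; apply/eqP.
rewrite eqn_leq word_length_le andbT.
have := word_lengthM (word_val u) (word_val v * word_val w).
have := word_lengthM (word_val v) (word_val w).
have := word_length_le u; have := word_length_le w; lia.
Qed.

End Words.

Lemma word_length_lipschitz (G : groupType) (X Y : {fset G}) :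
  monoid_generating X -> monoid_generating Y ->
  exists M, forall g, word_length Y g <= M * word_length X g.
Proof.
move=> genX genY; exists (\max_(x : X) word_length Y (fsval x)) => g.
have [u <- <-] := word_lengthP _ _ genX g; elim: u => [|x u IH].
  by rewrite word_val_nil word_length1.
rewrite word_val_cons mulnS; apply: leq_trans (word_lengthM _ _ genY _ _) _.
apply: leq_add => //; exact: (leq_bigmax x).
Qed.


Section VertexDist.
Variables (G : groupType) (X : {fset G}).
Hypothesis genX : monoid_generating X.
Local Open Scope group_scope.
Let S := sym_closure X.

Lemma sym_closure_generating : monoid_generating S.
Proof.
move=> g; have [u <-] := genX g; elim: u => [|x u [v IH]].
  by exists [::]; rewrite !word_val_nil.
have xS : fsval x \in S by rewrite inE fsvalP.
by exists ([` xS]%fset :: v); rewrite !word_val_cons IH.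
Qed.

Lemma sym_closureV x : (x^-1 \in S) = (x \in S).
Proof.
suff H y : y \in S -> y^-1 \in S by apply/idP/idP => /H //; rewrite invgK.
rewrite !inE => /orP[yX|/imfsetP [z zX ->]]; last by rewrite invgK zX.
by apply/orP; right; apply/imfsetP; exists y.
Qed.

Lemma sym_word_length_leV g : (word_length S g^-1 <= word_length S g)%N.
Proof.
have [u <- <-] := word_lengthP _ _ sym_closure_generating g.
suff [v -> <-] : exists2 v : seq S, (word_val u)^-1 = word_val v & size v = size u.
  exact: word_length_le.
elim: u => [|x u [v IH sv]]; first by exists [::]; rewrite // !word_val_nil invg1.
have xS : (fsval x)^-1 \in S by rewrite sym_closureV fsvalP.
exists (v ++ [:: [` xS]%fset]); last by rewrite size_cat sv addn1.
by rewrite word_val_cat !word_val_cons word_val_nil mulg1 invgM IH.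
Qed.

Lemma vertex_dist_mul k g h : vertex_dist X (k * g) (k * h) = vertex_dist X g h.
Proof. by rewrite /vertex_dist invgM -mulgA mulKg. Qed.

Lemma vertex_dist_graph_metric : graph_metric G (vertex_dist X).
Proof.
have gS := sym_closure_generating.
split=> [x|x y|x y|x y z|x y k kd]; rewrite /vertex_dist.
- by rewrite mulVg word_length1.
- by move=> /(word_length_eq0 _ _ gS) e; rewrite -(mulVKg x y) e mulg1.
- have le a b : (word_length S (a^-1 * b) <= word_length S (b^-1 * a))%N.
    by have := sym_word_length_leV (b^-1 * a); rewrite invgM invgK.
  by apply/eqP; rewrite eqn_leq !le.
- by have -> : x^-1 * z = (x^-1 * y) * (y^-1 * z); [rewrite -mulgA mulVKg | apply: word_lengthM].
have [u uv su] := word_lengthP _ _ gS (x^-1 * y).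
have gu : geodesic_word u by rewrite /geodesic_word uv.
have {}kd : (k <= size u)%N by rewrite su.
exists (x * word_val (take k u)).
  rewrite mulKg -(geodesic_word_infix _ _ gS [::] _ (drop k u)) ?cat_take_drop //.
  by rewrite size_takel.
rewrite -/S -su -size_drop invgM -mulgA -uv -{2}(cat_take_drop k u) word_val_cat mulKg.
by rewrite -(geodesic_word_infix _ _ gS (take k u) _ [::]) ?cats0 ?cat_take_drop.
Qed.

End VertexDist.

(** * Geometric realization *)

Import Order.TTheory GRing.Theory Num.Theory.

Section Cayley.
Variables (R : realType) (G : groupType) (X : {fset G}).
Hypothesis genX : monoid_generating X.
Local Open Scope ring_scope.
Let vd := vertex_dist X.
Let gm : graph_metric G vd := vertex_dist_graph_metric G X genX.
Let cd : cayley_point R X -> cayley_point R X -> R := @cayley_dist R G X.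

Definition base (p : cayley_point R X) : G := (exit0 p).1.

Definition is_exit (p : cayley_point R X) (e : G * R) := e = exit0 p \/ e = exit1 p.

Lemma vd_triR x y z : (vd x z)%:R <= (vd x y)%:R + (vd y z)%:R :> R.
Proof. by rewrite -natrD ler_nat; apply: (gm_tri _ _ gm). Qed.

Lemma vd_symR x y : (vd x y)%:R = (vd y x)%:R :> R.
Proof. by rewrite (gm_sym _ _ gm). Qed.

Lemma vd_xxR x : (vd x x)%:R = 0 :> R.
Proof. by rewrite (gm_xx _ _ gm). Qed.

Lemma vertex_dist_generator g (x : X) : (vd g (g * val x)%g <= 1)%N.
Proof.
rewrite /vd /vertex_dist mulKg.
have xS : val x \in sym_closure X by rewrite inE fsvalP.
by have := word_length_le G (sym_closure X) [:: [` xS]%fset]; rewrite word_val_cons word_val_nil mulg1.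
Qed.

Lemma via_verticesC (e f : G * R) : via_vertices X e f = via_vertices X f e.
Proof. by rewrite /via_vertices -/vd vd_symR; lra. Qed.

Lemma cayley_dist_le_via p q e f : is_exit p e -> is_exit q f -> cd p q <= via_vertices X e f.
Proof.
have le : cd p q <= Num.min
    (Num.min (via_vertices X (exit0 p) (exit0 q)) (via_vertices X (exit0 p) (exit1 q)))
    (Num.min (via_vertices X (exit1 p) (exit0 q)) (via_vertices X (exit1 p) (exit1 q))).
  by rewrite /cd; case: p q => [?|? ? ?] [?|? ? ?] //=; case: ifP; rewrite // ge_min lexx.
move=> pe qf; apply: le_trans le _.
by case: pe => ->; case: qf => ->; rewrite !ge_min lexx ?orbT.
Qed.

Lemma cayley_dist_le_edge g x t s :
  cd (CayleyInterior g x t) (CayleyInterior g x s) <= `|val t - val s|.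
Proof. by rewrite /cd /= !eqxx /= ge_min lexx orbT. Qed.

Lemma cayley_dist_ge p q r :
  (forall e f, is_exit p e -> is_exit q f -> r <= via_vertices X e f) ->
  (forall g x t s, p = CayleyInterior g x t -> q = CayleyInterior g x s -> r <= `|val t - val s|) ->
  r <= cd p q.
Proof.
move=> h1 h2.
have le : r <= Num.min
    (Num.min (via_vertices X (exit0 p) (exit0 q)) (via_vertices X (exit0 p) (exit1 q)))
    (Num.min (via_vertices X (exit1 p) (exit0 q)) (via_vertices X (exit1 p) (exit1 q))).
  by rewrite !le_min !h1 //; by [left|right].
rewrite /cd; case: p q h1 h2 le => [g|g x t] [h|h y s] //= h1 h2 le.
case: ifP => // /andP[/eqP e1 /eqP e2]; rewrite le_min le /=.
by apply: h2; [reflexivity|rewrite e1 e2].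
Qed.

Lemma cayley_distC p q : cd p q = cd q p.
Proof.
suff le p' q' : cd p' q' <= cd q' p' by apply/eqP; rewrite eq_le !le.
apply: cayley_dist_ge => [e f ee ff|g x t s -> ->].
  by rewrite via_verticesC; apply: cayley_dist_le_via.
by rewrite distrC; apply: cayley_dist_le_edge.
Qed.

Lemma exit_bounds p e : is_exit p e -> [/\ 0 <= e.2, e.2 <= 1 & (vd (base p) e.1 <= 1)%N].
Proof.
case: p => [g|g x [t t01]] [] ->; rewrite /base /= ?(gm_xx _ _ gm).
- by rewrite lexx ler01.
- by rewrite lexx ler01.
- by have /andP[t0 t1] := t01; split=> //; lra.
- by have /andP[t0 t1] := t01; split; [lra|lra|apply: vertex_dist_generator].
Qed.

(** Each point is within 1 of its [base], so coarse properties of the realization can be checked on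
    vertices. *)
Lemma cayley_dist_base p q : `|cd p q - (vd (base p) (base q))%:R| <= 2.
Proof.
have up : cd p q <= (vd (base p) (base q))%:R + 2.
  have ep : is_exit p (exit0 p) by left.
  have eq : is_exit q (exit0 q) by left.
  have := cayley_dist_le_via _ _ _ _ ep eq; have [] := exit_bounds _ _ ep; have [] := exit_bounds _ _ eq.
  rewrite /via_vertices -/vd -/(base p) -/(base q); lra.
have lo : (vd (base p) (base q))%:R - 2 <= cd p q.
  apply: cayley_dist_ge => [e f /exit_bounds [e0 e1 ve] /exit_bounds [f0 f1 vf]|g x t s -> ->].
    move: ve vf; rewrite -!(ler_nat R) /via_vertices -/vd => ve vf.
    have := vd_triR (base p) e.1 (base q); have := vd_triR e.1 f.1 (base q).
    have := vd_symR (base q) f.1; lra.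
  rewrite /base /= vd_xxR; have := normr_ge0 (val t - val s); lra.
by rewrite ler_norml; lra.
Qed.

(** Each inequality contains four distances, and passing to [base] changes each by at most 2: hence
    [8]. *)
Lemma four_point_cayley delta : four_point G vd delta -> forall p q r s,
  cd p q + cd r s <= cd p r + cd q s + (delta%:R + 8) \/
  cd p q + cd r s <= cd p s + cd q r + (delta%:R + 8).
Proof.
move=> fp p q r s; have := fp (base p) (base q) (base r) (base s).
rewrite addn_maxl leq_max.
have := cayley_dist_base p q; have := cayley_dist_base r s; have := cayley_dist_base p r.
have := cayley_dist_base q s; have := cayley_dist_base p s; have := cayley_dist_base q r.
rewrite !ler_norml => h1 h2 h3 h4 h5 h6.
by case/orP; rewrite -(ler_nat R) !natrD => h; [left|right]; lra.
Qed.

Lemma four_point_slim_triangles delta : four_point G vd delta ->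
  hyperbolicity_constant X (2 * (delta%:R + 8) : R).
Proof.
move=> /four_point_cayley fp x y z La Lb Lc a b c [La0 a0 aL da] [Lb0 b0 bL db] [Lc0 c0 cL dc] s sL.
set D := _ + 8 in fp *.
have D0 : 0 <= D by rewrite /D addr_ge0 // ler0n.
have dxy : cd x y = La by rewrite -a0 -aL /cd da ?ler0n ?lexx ?La0 //; rewrite sub0r normrN ger0_norm.
have dyz : cd y z = Lb by rewrite -b0 -bL /cd db ?ler0n ?lexx ?Lb0 //; rewrite sub0r normrN ger0_norm.
have dzx : cd z x = Lc by rewrite -c0 -cL /cd dc ?ler0n ?lexx ?Lc0 //; rewrite sub0r normrN ger0_norm.
have dxp : cd x (a s) = s by rewrite -a0 /cd da ?lexx ?La0 //; rewrite sub0r normrN ger0_norm; lra.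
have dyp : cd y (a s) = La - s by rewrite -aL /cd da ?lexx ?La0 //; rewrite ger0_norm; lra.
have C := cayley_distC.
(* [a s] is almost between [z] and either [x] or [y]. By a second instance it is close to the point
   of that side at the same distance from [x] or [y]; if the side is too short for this, [z] is
   close. *)
have [h|h] := fp x y z (a s); [right|left].
- have {}h : cd z (a s) + s <= Lc + D by have := C x z; have := C x (a s); have := C y (a s); lra.
  have [sLc|sLc] := leP s Lc; last first.
    by exists 0; rewrite ?lexx // c0 -/(cd _ _) (C _ z); lra.
  exists (Lc - s); first by lra.
  have dzr : cd z (c (Lc - s)) = Lc - s by rewrite -c0 /cd dc ?lexx ?Lc0 //; rewrite ?sub0r ?normrN ?ger0_norm; lra.
  have dxr : cd x (c (Lc - s)) = s by rewrite -cL /cd dc ?lexx ?Lc0 //; rewrite ?ger0_norm; lra.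
  have := fp (a s) (c (Lc - s)) x z.
  have := C (a s) x; have := C (a s) z; have := C x z; have := C x (c (Lc - s)).
  by have := C z (c (Lc - s)); rewrite -/(cd _ _); lra.
- have {}h : cd z (a s) + (La - s) <= Lb + D by have := C z (a s); lra.
  have [sLb|sLb] := leP (La - s) Lb; last first.
    by exists Lb; rewrite ?lexx ?Lb0 // bL -/(cd _ _) (C _ z); lra.
  exists (La - s); first by lra.
  have dzr : cd z (b (La - s)) = Lb - (La - s) by rewrite -bL /cd db ?lexx ?Lb0 //; rewrite ?ger0_norm; lra.
  have dyr : cd y (b (La - s)) = La - s by rewrite -b0 /cd db ?lexx ?Lb0 //; rewrite ?sub0r ?normrN ?ger0_norm; lra.
  have := fp (a s) (b (La - s)) y z.
  have := C (a s) y; have := C (a s) z; have := C y z; have := C y (b (La - s)).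
  by have := C z (b (La - s)); rewrite -/(cd _ _); lra.
Qed.

(** A unit edge, independent of the orientation of its generator. As [e 0] and [e 1] are vertices
    with one exit only, [edge_exit_left] and [edge_exit_right] ask for some exit at least as good as
    the route through [g] or [h]; these and [edge_dist] give upper bounds on distances, [edge_exit]
    and [edge_nonloop] lower bounds. *)
Record edge_parametrization (g h : G) (e : R -> cayley_point R X) : Prop := EdgeParametrization {
  edge_left : e 0 = CayleyVertex R X g;
  edge_right : e 1 = CayleyVertex R X h;
  edge_exit : forall t f, 0 <= t <= 1 -> is_exit (e t) f -> f = (g, t) \/ f = (h, 1 - t);
  edge_exit_left : forall t k, 0 <= t <= 1 ->
    exists2 f, is_exit (e t) f & f.2 + (vd f.1 k)%:R <= t + (vd g k)%:R;
  edge_exit_right : forall t k, 0 <= t <= 1 ->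
    exists2 f, is_exit (e t) f & f.2 + (vd f.1 k)%:R <= 1 - t + (vd h k)%:R;
  edge_nonloop : forall t g' x t', e t = CayleyInterior g' x t' -> g' != (g' * val x)%g;
  edge_dist : forall s t, 0 <= s <= 1 -> 0 <= t <= 1 -> cd (e s) (e t) <= `|s - t| }.

Lemma edge_parametrization_rev g h e :
  edge_parametrization g h e -> edge_parametrization h g (fun t => e (1 - t)).
Proof.
case=> el er ee exl exr en ed; have sym (t : R) : 0 <= t <= 1 -> 0 <= 1 - t <= 1 by lra.
split=> [||t f /sym t01|t k /sym t01|t k /sym t01|t g' x t'|s t /sym s01 /sym t01].
- by rewrite subr0.
- by rewrite subrr.
- by move=> /(ee _ _ t01) [] ->; [right|left]; rewrite // subKr.
- by have [f ? le] := exr _ k t01; exists f => //; move: le; rewrite subKr.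
- by have [f ? le] := exl _ k t01; exists f.
- exact: en.
by apply: le_trans (ed _ _ s01 t01) _; rewrite opprB addrC addrA subrK distrC.
Qed.

Lemma generator_edge g (x : X) : vd g (g * val x)%g = 1%N ->
  exists e, edge_parametrization g (g * val x)%g e.
Proof.
move=> v1.
have v1R : (vd g (g * val x)%g)%:R <= 1 :> R by rewrite v1.
pose e (t : R) := if insub t is Some t' then CayleyInterior g x t' else
  CayleyVertex R X (if t <= 0 then g else (g * val x)%g).
have eI (t : {t : R | 0 < t < 1}) : e (val t) = CayleyInterior g x t by rewrite /e valK.
have e0 : e 0 = CayleyVertex R X g by rewrite /e insubF ?lexx // ltxx.
have e1 : e 1 = CayleyVertex R X (g * val x)%g by rewrite /e insubF ?ltxx ?andbF // ler10.
have cases (t : R) : 0 <= t <= 1 -> [\/ t = 0, t = 1 | exists t' : {t : R | 0 < t < 1}, t = val t'].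
  move=> /andP[t0 t1]; have [->|n0] := eqVneq t 0; first by constructor 1.
  have [->|n1] := eqVneq t 1; first by constructor 2.
  have t01 : 0 < t < 1 by rewrite !lt_neqAle n1 t0 t1 eq_sym n0.
  by constructor 3; exists (Sub t t01).
have exl t k : 0 <= t <= 1 ->
    exists2 f, is_exit (e t) f & f.2 + (vd f.1 k)%:R <= t + (vd g k)%:R.
  move=> /cases [->|->|[t' ->]].
  - by exists (g, 0); rewrite ?e0 /=; [left|].
  - exists ((g * val x)%g, 0); rewrite ?e1 /=; first by left.
    have := vd_triR (g * val x)%g g k; have := vd_symR g (g * val x)%g; lra.
  - by exists (g, val t'); rewrite ?eI /=; [left|].
have exr t k : 0 <= t <= 1 ->
    exists2 f, is_exit (e t) f & f.2 + (vd f.1 k)%:R <= 1 - t + (vd (g * val x)%g k)%:R.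
  move=> /cases [->|->|[t' ->]].
  - exists (g, 0); rewrite ?e0 /=; first by left.
    have := vd_triR g (g * val x)%g k; lra.
  - exists ((g * val x)%g, 0); rewrite ?e1 /=; [by left|lra].
  - by exists ((g * val x)%g, 1 - val t'); rewrite ?eI /=; [right|].
exists e; split=> //.
- move=> t f /cases [->|->|[t' ->]].
  + by rewrite e0 => -[] -> /=; left.
  + by rewrite e1 subrr => -[] -> /=; right.
  + by rewrite eI => -[] -> /=; [left|right].
- move=> t g' x' t'; rewrite /e; case: insubP => [? _ _ [<- <- _]|_ //].
  by apply/eqP => gx; move: v1; rewrite -gx (gm_xx _ _ gm).
have ed0 t : 0 <= t <= 1 -> cd (e 0) (e t) <= `|0 - t|.
  move=> t01; have [f ft le] := exl t g t01.
  have l0 : is_exit (e 0) (g, 0) by rewrite e0; left.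
  have := cayley_dist_le_via _ _ _ _ l0 ft; rewrite sub0r normrN ger0_norm; last by lra.
  rewrite /via_vertices /= -/vd; have := vd_symR g f.1; have := vd_xxR g; lra.
have ed1 t : 0 <= t <= 1 -> cd (e 1) (e t) <= `|1 - t|.
  move=> t01; have [f ft le] := exr t (g * val x)%g t01.
  have l0 : is_exit (e 1) ((g * val x)%g, 0) by rewrite e1; left.
  have := cayley_dist_le_via _ _ _ _ l0 ft; rewrite ger0_norm; last by lra.
  rewrite /via_vertices /= -/vd; have := vd_symR (g * val x)%g f.1; have := vd_xxR (g * val x)%g; lra.
move=> s t s01 t01; case: (cases _ s01) => [->|->|[s' es]]; [exact: ed0|exact: ed1|].
case: (cases _ t01) => [->|->|[t' et]].
- by rewrite cayley_distC distrC; apply: ed0.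
- by rewrite cayley_distC distrC; apply: ed1.
by rewrite es et !eI; apply: cayley_dist_le_edge.
Qed.

Lemma adjacent_edge g h : vd g h = 1%N -> exists e, edge_parametrization g h e.
Proof.
move=> gh1; have [u uv] := word_lengthP _ _ (sym_closure_generating G X genX) (g^-1 * h)%g.
have -> : word_length (sym_closure X) (g^-1 * h)%g = 1%N by [].
case: u uv => [|y [|? ?]] // yv _; rewrite word_val_cons word_val_nil mulg1 in yv.
have := fsvalP y; rewrite inE yv => /orP[xX|/imfsetP [z /= zX zv]].
  have hE : h = (g * val [` xX]%fset)%g by rewrite /= mulVKg.
  by rewrite hE; apply: generator_edge; rewrite -hE.
have gE : g = (h * val [` zX]%fset)%g by rewrite /= -(invgK z) -zv invgM invgK mulVKg.
have [|e he] := generator_edge h [` zX]%fset.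
  by rewrite -gE (gm_sym _ _ gm) gh1.
by exists (fun t => e (1 - t)); rewrite gE; apply: edge_parametrization_rev.
Qed.

Section RealGeodesic.
Variables (n : nat) (v : nat -> G).
Hypothesis qv : quasigeodesic vd 1 n v.

Lemma quasigeodesic1_dist i j : (i <= j <= n)%N -> vd (v i) (v j) = (j - i)%N.
Proof.
move=> ij; case: qv => st lo; apply/eqP; rewrite eqn_leq.
rewrite (quasigeodesic_upper _ _ gm n) //=; have := lo _ _ ij; rewrite mul1n; exact.
Qed.

Lemma quasigeodesic1_distR i j : (i <= n)%N -> (j <= n)%N ->
  (vd (v i) (v j))%:R = `|i%:R - j%:R| :> R.
Proof.
move=> ni nj; wlog ij : i j ni nj / (i <= j)%N => [H|].
  by have [/H|/ltnW /H] := leqP i j => [->//|E]; rewrite vd_symR E // distrC.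
by rewrite quasigeodesic1_dist ?ij // natrB // distrC ger0_norm // subr_ge0 ler_nat.
Qed.

Lemma real_geodesic : exists c : R -> cayley_point R X,
  [/\ geodesic_segment cd (CayleyVertex R X (v 0)) (CayleyVertex R X (v n)) n%:R c,
      forall i, (i <= n)%N -> c i%:R = CayleyVertex R X (v i)
    & forall s : R, 0 <= s <= n%:R -> exists2 k, (k <= n)%N & base (c s) = v k].
Proof.
(* The constant path serves at the right end, where the truncation of the parameter is [n]. *)
have : forall i, exists e : R -> cayley_point R X,
    if (i < n)%N then edge_parametrization (v i) (v i.+1) e
    else e = fun=> CayleyVertex R X (v n).
  move=> i; case iN: (i < n)%N; last by eexists.
  by apply: adjacent_edge; rewrite (quasigeodesic1_dist i i.+1) ?subSnn //; lia.
move=> /choice [e he].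
pose tr (s : R) := Num.truncn s; pose c (s : R) := e (tr s) (s - (tr s)%:R).
have edge i : (i < n)%N -> edge_parametrization (v i) (v i.+1) (e i).
  by move=> iN; have := he i; rewrite iN.
have trP (s : R) : 0 <= s <= n%:R ->
    ((tr s < n)%N /\ 0 <= s - (tr s)%:R <= 1) \/ s = n%:R /\ c s = CayleyVertex R X (v n).
  move=> /andP[s0 sn]; have /andP[t1 t2] := truncn_itv s0.
  move: sn; rewrite le_eqVlt => /orP[/eqP sn|sn]; [right|left].
    by split=> //; rewrite /c /tr sn natrK; have := he n; rewrite ltnn => ->.
  rewrite -(ltr_nat R) (le_lt_trans t1 sn); split=> //.
  by rewrite -natr1 in t2; rewrite /tr; lra.
have cexit (s : R) f : 0 <= s <= n%:R -> is_exit (c s) f ->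
    exists2 k, (k <= n)%N & f = (v k, `|s - k%:R|).
  move=> /trP [[tn t01]|[-> ->]].
    move=> /(edge_exit _ _ _ (edge _ tn) _ _ t01) [] ->.
      by exists (tr s); [exact: ltnW|rewrite ger0_norm //; lra].
    exists (tr s).+1 => //; rewrite distrC ger0_norm -natr1; last by lra.
    by congr pair; lra.
  by exists n => //; rewrite subrr normr0; case: H => ->.
have cint (s : R) g x t : 0 <= s <= n%:R -> c s = CayleyInterior g x t -> g != (g * val x)%g.
  move=> /trP [[tn t01]|[_ ->]] // h; exact: (edge_nonloop _ _ _ (edge _ tn) _ _ _ _ h).
(* Every exit of [c s] is some [v k] at arc length [|s - k|], so routes through exits obey the
   triangle inequality of the line. For two points of one open edge, the edge is not a loop, so its
   ends are two distinct [v a] and [v b], and the arcs are compared directly. *)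
have lower (s t : R) : 0 <= s <= n%:R -> 0 <= t <= n%:R -> `|s - t| <= cd (c s) (c t).
  move=> s0 t0; apply: cayley_dist_ge => [f f' /(cexit _ _ s0) [k kn ->] /(cexit _ _ t0) [l ln ->]|].
    rewrite /via_vertices -/vd /= quasigeodesic1_distR //.
    have := ler_distD k%:R s t; have := ler_distD l%:R k%:R t; have := distrC l%:R t; lra.
  move=> g x p q cs ct; have gx := cint _ _ _ _ s0 cs.
  have [a an [ga ea]] : exists2 k, (k <= n)%N & (g, val p) = (v k, `|s - k%:R|).
    by apply: (cexit _ _ s0); rewrite cs; left.
  have [b bn [gb eb]] : exists2 k, (k <= n)%N & ((g * val x)%g, 1 - val p) = (v k, `|s - k%:R|).
    by apply: (cexit _ _ s0); rewrite cs; right.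
  have [a' an' [ga' ea']] : exists2 k, (k <= n)%N & (g, val q) = (v k, `|t - k%:R|).
    by apply: (cexit _ _ t0); rewrite ct; left.
  have [b' bn' [gb' eb']] : exists2 k, (k <= n)%N & ((g * val x)%g, 1 - val q) = (v k, `|t - k%:R|).
    by apply: (cexit _ _ t0); rewrite ct; right.
  have inj i j : (i <= n)%N -> (j <= n)%N -> v i = v j -> i = j.
    move=> iN jn vij; have := quasigeodesic1_distR i j iN jn; rewrite vij vd_xxR => /esym /normr0P.
    by rewrite subr_eq0 eqr_nat => /eqP.
  have aa' : a = a' by apply: inj => //; rewrite -ga -ga'.
  have bb' : b = b' by apply: inj => //; rewrite -gb -gb'.
  have ab : a != b by apply: contra gx => /eqP ab; rewrite gb ga ab.
  rewrite -aa' in ea'; rewrite -bb' in eb'.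
  change (val p = `|s - a%:R|) in ea; change (1 - val p = `|s - b%:R|) in eb.
  change (val q = `|t - a%:R|) in ea'; change (1 - val q = `|t - b%:R|) in eb'.
  have h1 := ler_norm (s - a%:R); have h2 := ler_norm (s - b%:R).
  have h3 := ler_norm (t - a%:R); have h4 := ler_norm (t - b%:R).
  have h5 := ler_norm (- (s - a%:R)); have h6 := ler_norm (- (s - b%:R)).
  have h7 := ler_norm (- (t - a%:R)); have h8 := ler_norm (- (t - b%:R)).
  rewrite !normrN in h5 h6 h7 h8.
  have [lt|lt] : a%:R + 1 <= b%:R :> R \/ b%:R + 1 <= a%:R :> R.
    by rewrite !natr1 !ler_nat; move: ab; rewrite neq_ltn => /orP[]; [left|right].
  - by have -> : s - t = val p - val q by lra.
  - have -> : s - t = - (val p - val q) by lra.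
    by rewrite normrN.
(* Unless the truncations agree, leave [c s] through the right end of its edge and reach [c t]
   through the left end of its own. *)
have upper (s t : R) : 0 <= s <= n%:R -> 0 <= t <= n%:R -> s <= t -> cd (c s) (c t) <= t - s.
  move=> s0 t0 st.
  have left_exit k : exists2 f, is_exit (c t) f & f.2 + (vd f.1 k)%:R <= t - (tr t)%:R + (vd (v (tr t)) k)%:R.
    have [[tn t01]|[tn ->]] := trP _ t0; first exact: (edge_exit_left _ _ _ (edge _ tn)).
    by exists (v n, 0); [left|rewrite tn /tr natrK subrr].
  have trt : (tr t <= n)%N by rewrite -(ler_nat R); apply: le_trans (_ : t <= _); rewrite ?truncn_le; lra.
  have [[sn s01]|[sn cs]] := trP _ s0; last first.
    have tE : t = n%:R by lra.
    have l0 : is_exit (c t) (v n, 0) by rewrite tE -sn cs; left.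
    have := cayley_dist_le_via _ _ _ _ l0 l0; rewrite tE sn /via_vertices -/vd /= vd_xxR; lra.
  have : (tr s <= tr t)%N by apply: le_truncn.
  rewrite leq_eqVlt => /orP[/eqP trE|ts].
    have [[tn t01]|[tn _]] := trP _ t0; last by rewrite trE tn /tr natrK ltnn in sn.
    have := edge_dist _ _ _ (edge _ tn) _ _ s01; rewrite {2}trE => /(_ _ t01).
    by rewrite /c trE => h; apply: le_trans h _; rewrite opprB addrA subrK distrC ger0_norm // subr_ge0.
  have [f' ft le'] := left_exit (v (tr s).+1).
  have [f fs le] := edge_exit_right _ _ _ (edge _ sn) _ f'.1 s01.
  apply: le_trans (cayley_dist_le_via _ _ _ _ fs ft) _; rewrite /via_vertices -/vd.
  have dst : (vd (v (tr s).+1) (v (tr t)))%:R = (tr t)%:R - (tr s).+1%:R :> R.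
    by rewrite quasigeodesic1_dist ?natrB // ts.
  have := vd_symR f'.1 (v (tr s).+1); have := vd_symR (v (tr t)) (v (tr s).+1).
  rewrite -natr1 in dst; lra.
have cn i : (i <= n)%N -> c i%:R = CayleyVertex R X (v i).
  move=> iN; have i0 : 0 <= (i%:R : R) <= n%:R by rewrite ler0n ler_nat.
  have [[tn _]|[iE ->]] := trP _ i0.
    by rewrite /c /tr natrK subrr; apply: edge_left; apply: edge; rewrite /tr natrK in tn.
  by move/eqP: iE; rewrite eqr_nat => /eqP ->.
exists c; split=> //.
  split; [exact: ler0n|by rewrite -[0]/(0%:R) cn|exact: cn|].
  move=> s t s0 t0; apply/eqP; rewrite eq_le lower // andbT.
  have [st|/ltW ts] := leP s t.
    by rewrite distrC ger0_norm ?subr_ge0 //; apply: upper.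
  by rewrite -/(cd _ _) cayley_distC ger0_norm ?subr_ge0 //; apply: upper.
move=> s s0; have [|k kn e0] := cexit _ (exit0 (c s)) s0; first by left.
by exists k => //; rewrite /base e0.
Qed.

End RealGeodesic.

(** A vertex geodesic through [w] and geodesics for the other two sides span a triangle in the
    realization. The [base] of the close point on another side is a vertex of the path of that
    side. *)
Lemma slim_triangles_slim_intervals (delta : R) :
  hyperbolicity_constant X delta -> exists h, slim_family vd (between vd) h.
Proof.
(* The [2] is the error of [cayley_dist_base], the absolute value covers a negative [delta], and the
   successor makes up for truncation. *)
move=> hyp; exists (Num.truncn (`|delta| + 2)).+1.
have geo x y w : between vd x y w -> exists p, [/\ p 0%N = x, p (vd x y) = y,
    quasigeodesic vd 1 (vd x y) p & exists2 i, (i <= vd x y)%N & p i = w].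
  move=> bw; have [p [p0 pw pn qp]] := geodesic_path_through _ _ gm _ _ _ bw.
  exists p; split=> //; exists (vd x w) => //; move: bw; rewrite /between; lia.
have bet x y p k : p 0%N = x -> p (vd x y) = y -> quasigeodesic vd 1 (vd x y) p ->
    (k <= vd x y)%N -> between vd x y (p k).
  move=> p0 pn qp kn; rewrite -{1}p0 -{1}pn.
  by apply: (quasigeodesic1_between _ _ gm _ _ _ qp kn); rewrite p0 pn.
have close p q : cd p q <= delta -> (vd (base p) (base q) <= (Num.truncn (`|delta| + 2)).+1)%N.
  move=> pq; have pos : 0 <= `|delta| + 2 by rewrite addr_ge0 ?normr_ge0.
  have /andP[_ t2] := truncn_itv pos; rewrite -(ler_nat R); apply/ltW/(le_lt_trans _ t2).
  have := cayley_dist_base p q; rewrite ler_norml; have := ler_norm delta; lra.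
split=> [x y z w bw|x y w]; last by rewrite /between; lia.
have bx a b : between vd a b a by rewrite /between (gm_xx _ _ gm).
have [p [p0 pn qp [i iN pi]]] := geo _ _ _ bw.
have [p' [p'0 p'n qp' _]] := geo _ _ _ (bx y z).
have [p'' [p''0 p''n qp'' _]] := geo _ _ _ (bx z x).
have [c [gc cn _]] := real_geodesic _ _ qp.
have [c' [gc' _ cb']] := real_geodesic _ _ qp'.
have [c'' [gc'' _ cb'']] := real_geodesic _ _ qp''.
rewrite p0 pn in gc; rewrite p'0 p'n in gc'; rewrite p''0 p''n in gc''.
have i0 : 0 <= (i%:R : R) <= (vd x y)%:R by rewrite ler0n ler_nat.
have := hyp _ _ _ _ _ _ _ _ _ gc gc' gc'' _ i0; rewrite cn // pi.
case=> -[s s0 /close]; rewrite {1}/base /=.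
  have [k kn ->] := cb' _ s0 => le; exists (p' k) => //; right.
  have := bet _ _ _ _ p'0 p'n qp' kn; rewrite /between.
  have := gm_sym _ _ gm y z; have := gm_sym _ _ gm y (p' k); have := gm_sym _ _ gm z (p' k); lia.
have [k kn ->] := cb'' _ s0 => le; exists (p'' k) => //; left.
have := bet _ _ _ _ p''0 p''n qp'' kn; rewrite /between.
have := gm_sym _ _ gm x z; have := gm_sym _ _ gm x (p'' k); have := gm_sym _ _ gm z (p'' k); lia.
Qed.

End Cayley.

(** * Conjugators *)

Section ConjugatorLength.
Variables (G : groupType) (X : {fset G}).
Hypothesis genX : monoid_generating X.
Local Open Scope group_scope.
Let vd := vertex_dist X.
Let genS := sym_closure_generating G X genX.

Definition word_path (a : G) (u : seq X) (i : nat) : G := a * word_val (take i u).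

(** Infixes of a geodesic word are geodesic over [X], and [K] compares lengths over [X] with those
    over the symmetrized set. As [X] need not be closed under inversion, the path need not be
    geodesic in the Cayley graph. *)
Lemma word_path_quasigeodesic K a (u : seq X) :
  (forall g, word_length X g <= K * word_length (sym_closure X) g)%N ->
  geodesic_word u -> quasigeodesic vd K (size u) (word_path a u).
Proof.
move=> hK gu; rewrite /word_path; split=> [i iu|i j ij].
  rewrite /vd vertex_dist_mul; case: u gu iu => // x0 u gu iu.
  rewrite (take_nth x0) // -cats1 word_val_cat word_val_cons word_val_nil mulg1.
  exact: vertex_dist_generator.
have ti : take i u = take i (take j u) by rewrite take_takel //; lia.
have eu : u = take i u ++ drop i (take j u) ++ drop j u.
  by rewrite ti catA !cat_take_drop.
have gi : geodesic_word (drop i (take j u)).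
  by apply: (geodesic_word_infix _ _ genX (take i u) _ (drop j u)); rewrite -eu.
have -> : (j - i)%N = size (drop i (take j u)) by rewrite size_drop size_takel //; lia.
rewrite gi; apply: leq_trans (hK _) _; rewrite leq_mul2l; apply/orP; right.
rewrite /vd vertex_dist_mul /vertex_dist ti -{3}(cat_take_drop i (take j u)).
by rewrite word_val_cat mulKg.
Qed.

(** This links geometry and words: conjugating [h] by the vertices of the path yields the cyclic
    permutations of [u]. *)
Lemma word_path_displacement h a (u : seq X) i : h * a = a * word_val u ->
  (word_path a u i)^-1 * (h * word_path a u i) = word_val (rot i u).
Proof.
move=> ha; rewrite /word_path (mulgA h) ha -!mulgA invgM -mulgA mulKg.
by rewrite -{2}(cat_take_drop i u) !word_val_cat -mulgA mulKg.
Qed.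

(** [h] commutes with its powers, so translating a path by them does not change the cyclic
    permutations read off at its vertices. *)
Lemma iter_displacement (h x : G) k :
  (iter k (fun y => h * y) x)^-1 * (h * iter k (fun y => h * y) x) = x^-1 * (h * x).
Proof. by elim: k => //= k IH; rewrite invgM -mulgA mulKg. Qed.

(** Words of length at most [K] form a finite type; a conjugator is chosen for each conjugate pair,
    and [C] is the largest length. *)
Lemma bounded_conjugators K : exists C, forall x y : G,
  (word_length (sym_closure X) x <= K)%N -> (word_length (sym_closure X) y <= K)%N ->
  (exists w, w * x = y * w) -> exists w, w * x = y * w /\ (word_length X w <= C)%N.
Proof.
pose B := K.-bseq (sym_closure X).
have : forall p : B * B, exists c, (exists w, w * word_val p.1 = word_val p.2 * w) ->
    exists w, w * word_val p.1 = word_val p.2 * w /\ (word_length X w <= c)%N.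
  move=> p; have [[w hw]|no] := EM (exists w, w * word_val p.1 = word_val p.2 * w).
    by exists (word_length X w) => _; exists w.
  by exists 0%N => /no.
move=> /choice [c hc]; exists (\max_p c p) => x y xK yK xy.
have [u ux su] := word_lengthP _ _ genS x; have [v vy sv] := word_lengthP _ _ genS y.
rewrite -su in xK; rewrite -sv in yK.
have := hc (Bseq xK, Bseq yK); rewrite /= ux vy => /(_ xy) [w [wxy le]].
by exists w; split=> //; apply: leq_trans le _; apply: leq_bigmax.
Qed.

Lemma slim_intervals_PCL_bounded h :
  slim_family vd (between vd) h -> exists C, forall n, (PCL X n <= C)%N.
Proof.
move=> sl; have gm := vertex_dist_graph_metric G X genX.
have [K hK] := word_length_lipschitz _ _ _ genS genX.
have {}hK g : (word_length X g <= K.+1 * word_length (sym_closure X) g)%N.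
  by apply: leq_trans (hK g) _; rewrite leq_mul2r leqnSn orbT.
have [K1 [C0 dich]] := both_small_displacement_or_close _ _ gm _ _ sl
  (slim_intervals_four_point _ _ gm _ sl) K.
have [C1 hC1] := bounded_conjugators K1.
(* [K.+1 * C0] serves paths with close translates, [C1] paths that both have a vertex of small
   displacement. *)
exists (maxn (K.+1 * C0) C1) => n; apply/bigmax_leqP => -[u v] /= /asboolP [gu gv [g gcon] _].
suff [w wP wC] : exists2 w, PC_conjugator u v w & (word_length X w <= maxn (K.+1 * C0) C1)%N.
  have [_ le] := nat_minP [set n | exists w, PC_conjugator u v w /\ word_length X w = n]%classic
    (word_length X w) (ex_intro _ w (conj wP erefl)).
  exact: leq_trans le wC.
pose z := word_val u; pose f x := z * x.
have fi x y : vd (f x) (f y) = vd x y by apply: vertex_dist_mul.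
(* With starting points [1] for [u] and [g^-1] for [v], left multiplication by [z] carries the start
   of each path to its end. *)
have z1 : z * 1 = 1 * word_val u by rewrite mulg1 mul1g.
have zg : z * g^-1 = g^-1 * word_val v.
  by rewrite -[in RHS](mulgK g (word_val v)) -gcon !mulgA mulVg mul1g.
have endp a (u' : seq X) : z * a = a * word_val u' -> word_path a u' (size u') = f (word_path a u' 0).
  by move=> e; rewrite /word_path take_size take0 word_val_nil mulg1 /f e.
have := dich f fi _ _ _ _ (word_path_quasigeodesic _ 1 _ hK gu) (word_path_quasigeodesic _ g^-1 _ hK gv)
  (endp _ _ z1) (endp _ _ zg).
have conj x y xu yv : x^-1 * (z * x) = xu -> y^-1 * (z * y) = yv -> (y^-1 * x) * xu = yv * (y^-1 * x).
  by move=> <- <-; rewrite -!mulgA mulVKg; rewrite mulVKg.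
case=> [[i [j [iu jv]]]|[i [j [k [l [iu jv le]]]]]].
  rewrite /vd /vertex_dist /f !word_path_displacement // => d1 d2.
  have [|w [w1 w2]] := hC1 _ _ d1 d2.
    exists ((word_path g^-1 v j)^-1 * word_path 1 u i).
    by apply: conj; apply: word_path_displacement.
  exists w; last by rewrite leq_max w2 orbT.
  by exists (rot i u), (rot j v); split; [exists i|exists j|].
exists ((iter l f (word_path g^-1 v j))^-1 * iter k f (word_path 1 u i)).
  exists (rot i u), (rot j v); split; [by exists i|by exists j|].
  by apply: conj; rewrite iter_displacement word_path_displacement.
rewrite leq_max; apply/orP; left; apply: leq_trans (hK _) _; rewrite leq_mul2l /=.
by move: le; rewrite (gm_sym _ _ gm).
Qed.

End ConjugatorLength.

Lemma hyperbolic_group_slim_intervals (R : realType) (G : groupType) (X : {fset G}) :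
  hyperbolic_group R G -> monoid_generating X ->
  exists h, slim_family (vertex_dist X) (between (vertex_dist X)) h.
Proof.
move=> [Y [genY [delta hyp]]] genX.
have [h sl] := slim_triangles_slim_intervals _ _ _ genY _ hyp.
have genSX := sym_closure_generating _ _ genX; have genSY := sym_closure_generating _ _ genY.
have [M1 h1] := word_length_lipschitz _ _ _ genSX genSY.
have [M2 h2] := word_length_lipschitz _ _ _ genSY genSX.
apply: (bilipschitz_slim_intervals _ _ _ (maxn M1 M2) h _ _ _ _ sl).
- exact: vertex_dist_graph_metric.
- exact: vertex_dist_graph_metric.
- by move=> x y; apply: leq_trans (h2 _) _; rewrite leq_mul2r leq_maxr orbT.
- by move=> x y; apply: leq_trans (h1 _) _; rewrite leq_mul2r leq_maxl orbT.
Qed.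

Theorem proposition3 (R : realType) (G : groupType)
    (hG : hyperbolic_group R G) (X : {fset G}) (hX : monoid_generating X) :
  (exists delta : R, hyperbolicity_constant X delta) /\
  (forall delta : R, hyperbolicity_constant X delta ->
     exists C : nat, forall n : nat, PCL X n <= C).
Proof.
have [h sl] := hyperbolic_group_slim_intervals _ _ _ hG hX.
have gm := vertex_dist_graph_metric _ _ hX.
split=> [|_ _]; last exact: (slim_intervals_PCL_bounded _ _ hX _ sl).
eexists; apply: (four_point_slim_triangles _ _ _ hX).
exact: (slim_intervals_four_point _ _ gm _ sl).
Qed.
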